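(* Let $a<b$ be real numbers, let $M\ge 1$ be an integer and let $T>0$. Let $G\colon[a,b]\to\mathbb{R}$ and $H\colon[a,b]\to\mathbb{C}$ be continuous functions such that $G$ is strictly monotone in $[a,b]$ and $H$ has no zeros in $[a,b]$. Let $$f(x)=\sum_{j=1}^{M} c_j\,H(x)\,e^{\alpha_j G(x)},\qquad x\in[a,b],$$ where $c_j\in\mathbb{C}\setminus\{0\}$ and where the $\alpha_j\in\mathbb{C}$ are pairwise different and satisfy $\operatorname{Im}\alpha_j\in(-T,T]$, $j=1,\dots,M$. Let $h\in\mathbb{R}$ satisfy $$0<|h|<\min\left\{\frac{\pi}{T},\ \frac{|G(b)-G(a)|}{2M}\right\}\quad\text{and}\quad \operatorname{sign} h=\operatorname{sign}(G(b)-G(a)),$$ and let $x_0\in[a,b]$ be such that $h\ell+G(x_0)\in G([a,b])$ for all $\ell=0,\dots,2M-1$. Then $f$ can be uniquely reconstructed from the sample values $$f\bigl(G^{-1}(h\ell+G(x_0))\bigr),\qquad \ell=0,\dots,2M-1.$$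
   Context: The functions $G$, $H$, the number of terms $M$, the bound $T$, the step size $h$ and the point $x_0$ are known; the parameters $c_j,\alpha_j$ are unknown. $G^{-1}\colon G([a,b])\to[a,b]$ denotes the inverse function of $G$. ''$f$ can be uniquely reconstructed from given samples'' means that the samples determine the set of parameter pairs $\{(\alpha_j,c_j): j=1,\dots,M\}$ uniquely: if $\tilde f(x)=\sum_{j=1}^{M}\tilde c_j H(x)e^{\tilde\alpha_j G(x)}$ is another expansion with $\tilde c_j\in\mathbb{C}\setminus\{0\}$ and pairwise different $\tilde\alpha_j\in\mathbb{C}$ with $\operatorname{Im}\tilde\alpha_j\in(-T,T]$ having the same samples, then $\{(\tilde\alpha_j,\tilde c_j)\}=\{(\alpha_j,c_j)\}$, and hence $\tilde f=f$. *)

(* Defs.v *)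
From HB Require Import structures.
From mathcomp Require Import all_boot all_order all_algebra.
From mathcomp Require Import all_classical all_reals all_analysis.
From mathcomp Require Import complex.

Set Implicit Arguments.
Unset Strict Implicit.
Unset Printing Implicit Defensive.

Import Order.TTheory GRing.Theory Num.Theory.
Import numFieldNormedType.Exports.

Local Open Scope classical_set_scope.
Local Open Scope ring_scope.
Local Open Scope complex_scope.

Definition cexp (R : realType) (z : R[i]) : R[i] :=
  (expR (complex.Re z))%:C
  * (cos (complex.Im z) +i* sin (complex.Im z)).

Definition strictly_monotone_on (R : realType) (D : set R) (G : R -> R) : Prop :=
  {in D &, {homo G : x y / x < y}} \/ {in D &, {homo G : x y /~ x < y}}.

(* The topology of the regular module R[i]^o is the one given by the modulus. *)
Definition complex_continuous_on (R : realType) (D : set R) (H : R -> R[i]) :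
    Prop :=
  {within D, continuous (H : R -> R[i]^o)}.

Definition admissible (R : realType) (T : R) (M : nat)
    (c alpha : 'I_M -> R[i]) : Prop :=
  [/\ forall j, c j != 0,
      injective alpha
    & forall j, complex.Im (alpha j) \in `]- T, T]].

Definition expsum (R : realType) (G : R -> R) (H : R -> R[i]) (M : nat)
    (c alpha : 'I_M -> R[i]) (x : R) : R[i] :=
  \sum_(j < M) c j * H x * cexp (alpha j * (G x)%:C).

(* For G injective on [a, b], this is the inverse G([a, b]) -> [a, b]; off
   G([a, b]) it takes the junk value a. *)
Definition inverse_on (R : realType) (a b : R) (G : R -> R) : R -> R :=
  'pinv_(fun=> a) `[a, b] G.

Definition sample (R : realType) (a b : R) (G : R -> R) (h x0 : R)
    (f : R -> R[i]) (l : nat) : R[i] :=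
  f (inverse_on a b G (h * l%:R + G x0)).

Definition param_pairs (R : realType) (M : nat) (c alpha : 'I_M -> R[i]) :
    set (R[i] * R[i]) :=
  range (fun j => (alpha j, c j)).

(* The expansion f with parameters (c, alpha) can be uniquely reconstructed from
   its samples with indices l < N: every admissible expansion with M terms and
   the same samples has the same set of parameter pairs, hence is equal to f. *)
Definition uniquely_reconstructible (R : realType) (a b T : R) (G : R -> R)
    (H : R -> R[i]) (h x0 : R) (N M : nat) (c alpha : 'I_M -> R[i]) : Prop :=
  forall c' alpha' : 'I_M -> R[i],
    admissible T c' alpha' ->
    (forall l : nat, (l < N)%N ->
       sample a b G h x0 (expsum G H c' alpha') l
       = sample a b G h x0 (expsum G H c alpha) l) ->
    param_pairs c' alpha' = param_pairs c alpha
    /\ {in `[a, b], expsum G H c' alpha' =1 expsum G H c alpha}.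

(* Main.v *)
(* Prony's argument. At the sample points the expansions are H times power
   sums in the nodes exp (alpha_j h) with weights c_j exp (alpha_j G(x0)), and
   |h| < pi / T makes alpha |-> exp (alpha h) injective on the strip
   Im alpha in (-T, T]. If two such power sums agree for all exponents l < 2M,
   their weighted sums of values of any polynomial of degree < 2M agree;
   a polynomial that vanishes at every node of both sums except a chosen one
   shows that this node, with its weight, occurs in both. *)
Require Import Defs.
From HB Require Import structures.
From mathcomp Require Import all_boot all_order all_algebra.
From mathcomp Require Import all_classical all_reals all_analysis.
From mathcomp Require Import complex.
From mathcomp Require Import lra.
Import Order.TTheory GRing.Theory Num.Theory.
Import numFieldNormedType.Exports.
Local Open Scope classical_set_scope.
Local Open Scope ring_scope.
Local Open Scope complex_scope.

Set Implicit Arguments.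
Unset Strict Implicit.
Unset Printing Implicit Defensive.

Section ExponentialSums.
Variable F : fieldType.

Lemma size_prod_XsubC_cond (I : finType) (P : pred I) (x : I -> F) :
  size (\prod_(i | P i) ('X - (x i)%:P)) = #|P|.+1.
Proof.
by rewrite -big_enum size_prod_XsubC -cardE.
Qed.

Lemma power_sums_horner (I J : finType) (N : nat) (d z : I -> F)
    (d' z' : J -> F) (p : {poly F}) :
  (forall l, (l < N)%N ->
     \sum_i d i * z i ^+ l = \sum_j d' j * z' j ^+ l) ->
  (size p <= N)%N ->
  \sum_i d i * p.[z i] = \sum_j d' j * p.[z' j].
Proof.
move=> eq_sums le_p_N.
have E (K : finType) (e y : K -> F) :
    \sum_k e k * p.[y k] = \sum_(l < N) p`_l * \sum_k e k * y k ^+ l.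
  under eq_bigr => k _ do rewrite (horner_coef_wide _ le_p_N) mulr_sumr.
  rewrite exchange_big; apply: eq_bigr => l _.
  by rewrite mulr_sumr; apply: eq_bigr => k _; rewrite mulrCA.
by rewrite !E; apply: eq_bigr => l _; rewrite eq_sums.
Qed.

(** Both families have [M] nodes, so the injection [s] is a permutation; it is enough to find each
    [z j], with its weight, among the [z']. *)
Lemma power_sums_unique (M : nat) (d z d' z' : 'I_M -> F) :
  injective z -> injective z' -> (forall j, d j != 0) ->
  (forall l, (l < 2 * M)%N ->
     \sum_j d j * z j ^+ l = \sum_j d' j * z' j ^+ l) ->
  exists2 s : 'I_M -> 'I_M, injective s
    & forall j, z' (s j) = z j /\ d' (s j) = d j.
Proof.
move=> z_inj z'_inj d_neq0 eq_sums.
suff /fin_all_exists[s sP] j : exists k, z' k = z j /\ d' k = d j.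
  by exists s => // i j eq_s; apply: z_inj; rewrite -(sP i).1 -(sP j).1 eq_s.
(* p vanishes at all the nodes except z j, and has size at most 2M. *)
pose p := \prod_(i | i != j) ('X - (z i)%:P)
          * \prod_(i | z' i != z j) ('X - (z' i)%:P).
(* The first product has [M - 1] linear factors and the second at most [M], so the degree is at most
   [2 * M - 1]. The index [j] itself shows that [M] is positive. *)
have size_p : (size p <= 2 * M)%N.
  apply: leq_trans (size_polyMleq _ _) _.
  rewrite !size_prod_XsubC_cond cardC1 card_ord addnS /= mul2n -addnn.
  rewrite prednK ?(leq_ltn_trans _ (ltn_ord j)) // leq_add2l.
  by apply: leq_trans (max_card _) _; rewrite card_ord.
have p_z i : i != j -> p.[z i] = 0.
  move=> neq_ij; rewrite hornerM horner_prod (bigD1 i) //=.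
  by rewrite hornerXsubC subrr !mul0r.
have p_z' i : z' i != z j -> p.[z' i] = 0.
  move=> neq_ij; rewrite hornerM mulrC horner_prod (bigD1 i) //=.
  by rewrite hornerXsubC subrr !mul0r.
have p_zj : p.[z j] != 0.
  rewrite hornerM !horner_prod mulf_neq0 //; apply/prodf_neq0 => i neq_i;
    rewrite hornerXsubC subr_eq0 eq_sym ?(inj_eq z_inj) //.
have := power_sums_horner eq_sums size_p.
rewrite (bigD1 j) //= [X in _ + X = _]big1 ?addr0; last first.
  by move=> i /p_z ->; rewrite mulr0.
(* The left side is now [d j * p.[z j]], which is nonzero. The right side keeps only a term whose
   node is [z j]; without such a term it would vanish. *)
have [k /eqP eq_kj | no_k] := pickP (fun k => z' k == z j).
  rewrite (bigD1 k) //= [X in _ = _ + X]big1 ?addr0; last first.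
    move=> i neq_ik; rewrite p_z' ?mulr0 //.
    by rewrite -eq_kj (inj_eq z'_inj).
  by rewrite eq_kj => /(mulIf p_zj) ->; exists k.
rewrite [RHS]big1 => [/eqP|i _]; last by rewrite p_z' ?no_k ?mulr0.
by rewrite mulf_eq0 (negPf (d_neq0 j)) (negPf p_zj).
Qed.

End ExponentialSums.

Section ComplexExponential.
Variable R : realType.
Implicit Types z w : R[i].

Lemma cexp0 : cexp (0 : R[i]) = 1.
Proof. by rewrite /cexp /= expR0 cos0 sin0 mul1r. Qed.

Lemma cexpD z w : cexp (z + w) = cexp z * cexp w.
Proof.
case: z w => [x y] [u v]; rewrite /cexp /= expRD cosD sinD mulrACA.
rewrite rmorphM; congr (_ * _); apply/eqP; rewrite eq_complex /= eqxx /=.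
by rewrite addrC.
Qed.

Lemma cexp_neq0 z : cexp z != 0.
Proof.
apply: contra_eq_neq (cexp0) => /= z0.
by rewrite -(subrr z) cexpD z0 mul0r eq_sym oner_neq0.
Qed.

Lemma cexpMn z (n : nat) : cexp (z * n%:R) = cexp z ^+ n.
Proof.
elim: n => [|n IHn]; first by rewrite mulr0 cexp0 expr0.
by rewrite -natr1 mulrDr mulr1 cexpD IHn exprSr.
Qed.

Lemma cexp_eq1 z : `|complex.Im z| < pi *+ 2 -> cexp z = 1 -> z = 0.
Proof.
case: z => x y /=; rewrite /cexp /= => lt_y /eqP.
rewrite eq_complex /= !mul0r subr0 addr0 => /andP[/eqP cos1 /eqP sin_y0].
have {}sin_y0 : sin y = 0.
  by apply/eqP; move: sin_y0 => /eqP; rewrite mulf_eq0 gt_eqF ?expR_gt0.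
(* The vanishing sine leaves 1 or -1, and the positive real exponential fixes the sign. *)
have cos_y1 : cos y = 1.
  have cos_gt0 : 0 < cos y by rewrite -(pmulr_rgt0 _ (expR_gt0 x)) cos1.
  by rewrite -(gtr0_norm cos_gt0) (sin0cos1 sin_y0).
have /eqP y0 : y == 0.
  (* Half-angle formula: [cos y = 1] kills the sine of half of [|y|], which lies in [0, pi), where
     sine vanishes only at 0. *)
  have : sin (`|y| / 2) == 0.
    rewrite -sqrf_eq0; move: cos_y1; rewrite -cos_norm.
    rewrite -{1}[`|y|](divfK (_ : 2 != 0)) // mulr_natr cos_mulr2n cos2sin2.
    by move=> ?; apply/eqP; lra.
  apply: contraLR => y_neq0; rewrite gt_eqF // sin_gt0_pi //.
  by rewrite divr_gt0 ?normr_gt0 //= ltr_pdivrMr // mulr_natr.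
by move: cos1; rewrite y0 cos0 mulr1 -expR0 => /expR_inj ->.
Qed.

Lemma cexp_inj z w :
  `|complex.Im z - complex.Im w| < pi *+ 2 -> cexp z = cexp w -> z = w.
Proof.
move=> lt_zw eq_zw; apply/eqP; rewrite -subr_eq0; apply/eqP/cexp_eq1.
  by case: z w lt_zw {eq_zw} => [? ?] [? ?].
by rewrite cexpD eq_zw -cexpD subrr cexp0.
Qed.

(** In the half-open strip two imaginary parts differ by strictly less than [2 * T], so after
    scaling by [h] they differ by less than a full period. *)
Lemma cexp_mulr_inj (T h : R) z w :
  h != 0 -> `|h| * T < pi ->
  complex.Im z \in `]- T, T] -> complex.Im w \in `]- T, T] ->
  cexp (z * h%:C) = cexp (w * h%:C) -> z = w.
Proof.
move=> h_neq0 hT; rewrite !in_itv /= => /andP[lz uz] /andP[lw uw] eq_zw.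
have hC_neq0 : h%:C != 0 by rewrite eq_complex /= eqxx andbT.
apply: (mulIf hC_neq0); apply: cexp_inj eq_zw.
have ImM (u : R[i]) : complex.Im (u * h%:C) = complex.Im u * h.
  by case: u => ? ? /=; rewrite mulr0 add0r.
rewrite !ImM -mulrBl normrM mulrC.
apply: lt_trans (_ : `|h| * (T *+ 2) < _); last by rewrite mulrnAr ltr_pMn2r.
by rewrite ltr_pM2l ?normr_gt0 // ltr_norml; lra.
Qed.

(** On the image of [G] the value of [inverse_on] is a true preimage, so the exponent is affine in
    [l]: the offset [G x0] goes into the weights and the step [h] into the nodes. *)
Lemma sample_expsum (a b h x0 : R) (G : R -> R) (H : R -> R[i]) (M l : nat)
    (c alpha : 'I_M -> R[i]) :
  (G @` `[a, b]) (h * l%:R + G x0) ->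
  sample a b G h x0 (expsum G H c alpha) l
  = H (inverse_on a b G (h * l%:R + G x0))
    * \sum_j c j * cexp (alpha j * (G x0)%:C) * cexp (alpha j * h%:C) ^+ l.
Proof.
move=> im_l; rewrite /sample /expsum mulr_sumr; apply: eq_bigr => j _.
rewrite [G (inverse_on _ _ _ _)]pinvK ?inE // -cexpMn.
rewrite -[_ * cexp _ * cexp _]mulrA -cexpD -mulrA mulrCA.
congr (_ * (_ * cexp _)).
by rewrite rmorphD rmorphM rmorph_nat mulrDr mulrA addrC.
Qed.

End ComplexExponential.

Theorem theorem2 (R : realType) (a b : R) (hab : a < b)
    (M : nat) (hM : (1 <= M)%N) (T : R) (hT : 0 < T)
    (G : R -> R) (H : R -> R[i])
    (hGcont : {within `[a, b], continuous G})
    (hHcont : complex_continuous_on `[a, b] H)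
    (hGmono : strictly_monotone_on `[a, b] G)
    (hHnz : forall x : R, x \in `[a, b] -> H x != 0)
    (c alpha : 'I_M -> R[i]) (hadm : admissible T c alpha)
    (h : R)
    (hh0 : 0 < `|h|)
    (hhlt : `|h| < Num.min (pi / T) (`|G b - G a| / (2 * M)%:R))
    (hsign : Num.sg h = Num.sg (G b - G a))
    (x0 : R) (hx0 : x0 \in `[a, b])
    (hgrid : forall l : nat, (l < 2 * M)%N ->
       (G @` `[a, b]) (h * l%:R + G x0)) :
  uniquely_reconstructible a b T G H h x0 (2 * M) c alpha.
Proof.
case: hadm => c_neq0 alpha_inj alphaT c' alpha' [_ alpha'_inj alpha'T] eq_smp.
have h_neq0 : h != 0 by rewrite -normr_gt0.
have hT_pi : `|h| * T < pi.
  by move: hhlt; rewrite lt_min => /andP[+ _]; rewrite ltr_pdivlMr.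
have [s s_inj sP] : exists2 s : 'I_M -> 'I_M, injective s & forall j,
    cexp (alpha' (s j) * h%:C) = cexp (alpha j * h%:C) /\
    c' (s j) * cexp (alpha' (s j) * (G x0)%:C)
      = c j * cexp (alpha j * (G x0)%:C).
  apply: (power_sums_unique
    (z := fun j => cexp (alpha j * h%:C))
    (z' := fun j => cexp (alpha' j * h%:C))
    (d := fun j => c j * cexp (alpha j * (G x0)%:C))
    (d' := fun j => c' j * cexp (alpha' j * (G x0)%:C))).
  - by move=> i j /(cexp_mulr_inj h_neq0 hT_pi (alphaT i) (alphaT j))/alpha_inj.
  - move=> i j.
    by move=> /(cexp_mulr_inj h_neq0 hT_pi (alpha'T i) (alpha'T j))/alpha'_inj.
  - by move=> j; rewrite mulf_neq0 ?cexp_neq0.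
  - move=> l lt_l; apply/esym; move: (eq_smp l lt_l); rewrite !sample_expsum.
    2,3: exact: hgrid.
    (* Both samples carry the same factor [H], taken at a point of [[a, b]], so it cancels. *)
    apply/mulfI/hHnz.
    apply: (@surjpinv_image_sub _ _ (fun=> a) [set` `[a, b]] _ G
              (@subset_refl _ _)).
    by exists (h * l%:R + G x0); first exact: hgrid.
have alphaE j : alpha' (s j) = alpha j.
  exact: cexp_mulr_inj h_neq0 hT_pi (alpha'T _) (alphaT _) (sP j).1.
have cE j : c' (s j) = c j.
  by have := (sP j).2; rewrite alphaE => /mulIf; apply; exact: cexp_neq0.
split; last first.
  move=> x _; rewrite /expsum (reindex_inj s_inj).
  by apply: eq_bigr => j _; rewrite alphaE cE.
(* An index of the primed family is pulled back through the inverse of the permutation [s]. *)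
apply/seteqP; split=> _ [j _ <-]; last by exists (s j); rewrite ?alphaE ?cE.
by exists (invF s_inj j); rewrite // -alphaE -cE f_invF.
Qed.
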